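(* Let $\{a_k\}_{k=0}^{\infty}$ be a sequence of complex numbers with $a_0=0$, and let $b_n = \sum_{k=0}^{n}\binom{n}{k}(-1)^{k-1}a_k$ for $n\ge 0$ (so that $b_0=0$ too). Then for every complex number $\lambda\neq -1,-2,\ldots$ (that is, $\lambda$ is not a negative integer) and every integer $n\geq 1$, $$\sum_{k=1}^{n}\binom{n}{k}(-1)^{k-1}\frac{a_k}{k+\lambda}=\sum_{m=1}^{n}\frac{(m+1)(m+2)\cdots n}{(\lambda+m)(\lambda+m+1)\cdots(\lambda+n)}\,b_m = n!\sum_{m=1}^{n}\frac{b_m}{m!\,(\lambda+m)(\lambda+m+1)\cdots(\lambda+n)} .$$
   Context: The binomial transform of a sequence $\{a_k\}_{k\ge0}$ is the sequence $\{b_n\}_{n\ge0}$ with $b_n=\sum_{k=0}^{n}\binom{n}{k}(-1)^{k-1}a_k$ (the $k=0$ factor $(-1)^{-1}$ equals $-1$). The product $(m+1)(m+2)\cdots n$ is $\prod_{j=m+1}^{n}j$, equal to $1$ (empty product) when $m=n$; the product $(\lambda+m)(\lambda+m+1)\cdots(\lambda+n)$ is $\prod_{j=m}^{n}(\lambda+j)$. *)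

(* Defs.v *)
From mathcomp Require Import all_boot all_order all_algebra.
From mathcomp Require Import complex.
Set Implicit Arguments.
Unset Strict Implicit.
Unset Printing Implicit Defensive.
Import GRing.Theory.
Local Open Scope ring_scope.

(* The exponent k - 1 is an integer, so the k = 0 term carries the sign
   (-1) ^ (-1) = -1. *)
Definition binomial_transform (F : fieldType) (a : nat -> F) (n : nat) : F :=
  \sum_(0 <= k < n.+1) 'C(n, k)%:R * (-1) ^ (k%:Z - 1) * a k.

(* Main.v *)
Require Import Defs.
From mathcomp Require Import all_boot all_order all_algebra.
From mathcomp Require Import complex.
From mathcomp Require Import reals.
From mathcomp Require Import ring.
Set Implicit Arguments.
Unset Strict Implicit.
Unset Printing Implicit Defensive.
Import GRing.Theory.
Local Open Scope ring_scope.

(** Let S n be the left-hand sum, in which the k-th term of the binomial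
    transform is divided by k + lambda, and T n the middle sum.  Writing
    n + lambda = (k + lambda) + (n - k), and using
    (n - k) 'C(n, k) = n 'C(n - 1, k), gives

      (n + lambda) S n = b n + n S (n - 1)

    ([damped_transform_rec]): the part with k + lambda cancels the denominator
    and leaves b n itself, whose k = 0 term vanishes because a 0 = 0.  Passing
    from n - 1 to n multiplies each earlier coefficient of T by n / (lambda + n)
    and adds a new term b n / (lambda + n), so T obeys the same first-order recurrence
    ([product_sum_rec]).  Both sums are empty at n = 0, and lambda + n never
    vanishes for n >= 1, so they agree.  The second equality is the termwise
    identity (m + 1) ... n = n! / m!. *)

Section Recurrence.
Variables (F : fieldType) (lambda : F).

Definition damped_transform (a : nat -> F) n : F :=
  \sum_(1 <= k < n.+1) 'C(n, k)%:R * (-1) ^ (k%:Z - 1) * (a k / (k%:R + lambda)).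

Definition product_sum (b : nat -> F) n : F :=
  \sum_(1 <= m < n.+1)
    (\prod_(m.+1 <= j < n.+1) j%:R) / (\prod_(m <= j < n.+1) (lambda + j%:R))
      * b m.

Lemma product_sum_rec b n :
  product_sum b n.+1 = (n.+1%:R * product_sum b n + b n.+1) / (lambda + n.+1%:R).
Proof.
rewrite /product_sum big_nat_recr //= (@big_geq _ _ _ n.+2) // big_nat1 mulrDl; congr (_ + _).
  rewrite mulr_sumr mulr_suml; apply: eq_big_nat => m /andP[_ lt_mn].
  rewrite big_nat_recr //= [X in _ / X]big_nat_recr /=; last exact: ltnW.
  by rewrite invfM; ring.
by rewrite mul1r mulrC.
Qed.

Lemma binomial_transform_tail (a : nat -> F) n : a 0%N = 0 ->
  binomial_transform a n
    = \sum_(1 <= k < n.+1) 'C(n, k)%:R * (-1) ^ (k%:Z - 1) * a k.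
Proof.
by move=> a0; rewrite /binomial_transform big_nat_recl //= a0 mulr0 add0r big_add1.
Qed.

Hypothesis shift_neq0 : forall j, (1 <= j)%N -> lambda + j%:R != 0.

(** The recurrence holds termwise: multiplied through by lambda + n + 1, it
    reads, apart from the common factor (-1) ^ (k - 1) a k / (k + lambda),
    (n + 1 + lambda) 'C(n + 1, k) = (n + 1) 'C(n, k) + (k + lambda) 'C(n + 1, k),
    which is the absorption identity (n + 1) 'C(n, k) = (n + 1 - k) 'C(n + 1, k). *)
Lemma damped_transform_rec a n : a 0%N = 0 ->
  damped_transform a n.+1
    = (n.+1%:R * damped_transform a n + binomial_transform a n.+1)
        / (lambda + n.+1%:R).
Proof.
move=> a0; apply: (canRL (mulfK (shift_neq0 _))) => //.
rewrite binomial_transform_tail // /damped_transform.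
(* The sum of length n is padded with its zero term k = n + 1. *)
have -> : \sum_(1 <= k < n.+1)
    'C(n, k)%:R * (-1) ^ (k%:Z - 1) * (a k / (k%:R + lambda))
  = \sum_(1 <= k < n.+2)
    'C(n, k)%:R * (-1) ^ (k%:Z - 1) * (a k / (k%:R + lambda)) :> F.
  by rewrite [RHS]big_nat_recr //= bin_small // !mul0r addr0.
rewrite mulr_suml mulr_sumr -big_split /=.
apply: eq_big_nat => k /andP[k_gt0 le_kn].
have absorb : n.+1%:R * 'C(n, k)%:R = (n.+1%:R - k%:R) * 'C(n.+1, k)%:R :> F.
  by rewrite -natrB // -!natrM mul_bin_down.
have kl : k%:R + lambda != 0 by rewrite addrC shift_neq0.
rewrite !mulrA absorb.
by field.
Qed.

Lemma damped_transformE a n : a 0%N = 0 ->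
  damped_transform a n = product_sum (binomial_transform a) n.
Proof.
move=> a0; elim: n => [|n IHn].
  by rewrite /damped_transform /product_sum !big_geq.
by rewrite damped_transform_rec // IHn product_sum_rec.
Qed.

End Recurrence.

Lemma natr_prod_fact (R : comPzRingType) m n : (m <= n)%N ->
  m`!%:R * \prod_(m.+1 <= j < n.+1) j%:R = n`!%:R :> R.
Proof.
by move=> le_mn; rewrite -natr_prod -natrM !fact_prod -big_cat_nat.
Qed.

Theorem corollary3 (R : realType) (a b : nat -> R[i]) (lambda : R[i]) (n : nat)
  (a0 : a 0%N = 0)
  (b_def : forall m : nat, b m = binomial_transform a m)
  (lambda_not_negint : forall j : nat, (1 <= j)%N -> lambda <> - j%:R)
  (n_ge1 : (1 <= n)%N) :
  \sum_(1 <= k < n.+1) 'C(n, k)%:R * (-1) ^ (k%:Z - 1) * (a k / (k%:R + lambda))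
  = \sum_(1 <= m < n.+1)
      (\prod_(m.+1 <= j < n.+1) j%:R) / (\prod_(m <= j < n.+1) (lambda + j%:R))
        * b m
  /\
  \sum_(1 <= m < n.+1)
      (\prod_(m.+1 <= j < n.+1) j%:R) / (\prod_(m <= j < n.+1) (lambda + j%:R))
        * b m
  = n`!%:R *
    \sum_(1 <= m < n.+1)
      b m / (m`!%:R * \prod_(m <= j < n.+1) (lambda + j%:R)).
Proof.
split.
  rewrite -[LHS]/(damped_transform lambda a n) damped_transformE //.
    by apply: eq_bigr => m _; rewrite b_def.
  by move=> j j_gt0; rewrite addr_eq0; apply/eqP/lambda_not_negint.
rewrite mulr_sumr; apply: eq_big_nat => m /andP[_].
rewrite ltnS => le_mn.
have fact_neq0 : m`!%:R != 0 :> R[i].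
  by rewrite Num.Theory.pnatr_eq0 -lt0n fact_gt0.
rewrite -(natr_prod_fact _ le_mn) invfM.
by rewrite [b m * _]mulrCA mulrACA mulfV // mul1r mulrAC mulrA.
Qed.
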